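(* Let $w\in S_n$ be a $k$-Grassmannian permutation. Then $\mathcal{IT}(w)$ consists of exactly all fillings of the staircase $\{(i,j):1\le i<j\le n\}$ (with $0$ in the unshaded boxes) whose shaded boxes form a reverse semistandard Young tableau of shape $\lambda_w$ with top left corner in position $(k,k+1)$, and whose entries in the shaded boxes are in $\{1,\dots,k\}$.
   Context: A permutation $w=w_1\cdots w_n\in S_n$ is $k$-Grassmannian if it has exactly one descent and this descent is at position $k$, i.e. $w_k>w_{k+1}$. Writing $w=a_1a_2\cdots a_kb_1b_2\cdots b_{n-k}$ in one-line notation, $\lambda_w=(a_k-k,\dots,a_2-2,a_1-1)$. $\mathrm{Inv}(w)=\{(i,j): i<j,\ w_j<w_i\}$. The staircase consists of the boxes $(i,j)$, $1\le i<j\le n$, with row index $i$ and column index $j$; rows are drawn with index increasing from bottom to top and columns with index increasing from left to right. The inversions diagram of $w$ is the staircase with box $(i,j)$ shaded exactly when $(i,j)\in\mathrm{Inv}(w)$. An inversions tableau of shape $w$ assigns a number $T(i,j)\in\{1,\dots,n\}$ to each shaded box, with $T(i,j)=0$ for unshaded boxes, such that: (IT1) for all $i<j$, $T(i,j)$ is the median (counting multiplicities) of the entries of $T$ in the hook $\{(i,j)\}\cup\{(i',j): i<i'<j\}\cup\{(i,j'): i<j'<j\}$; (IT2) no two shaded boxes in the same column have the same entry; (IT3) $T(i,i+1)\le i$ for all $1\le i<n$. $\mathcal{IT}(w)$ is the set of inversions tableaux of shape $w$. A reverse semistandard Young tableau of shape $\lambda$ is a filling of the Young diagram of $\lambda$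 (rows left-justified, drawn from top to bottom with lengths $\lambda_1\ge\lambda_2\ge\cdots$) whose entries weakly decrease along rows from left to right and strictly decrease down columns. ''Top left corner in position $(k,k+1)$'' means that the $r$-th row of $\lambda_w$ occupies the boxes $(k+1-r,k+1),(k+1-r,k+2),\dots,(k+1-r,k+\lambda_r)$ of the staircase. *)

(* Defs.v *)
From mathcomp Require Import all_boot all_fingroup.

Set Implicit Arguments.
Unset Strict Implicit.
Unset Printing Implicit Defensive.

(** All indices are 1-based: positions and letters of a permutation, rows and
    columns of the staircase, and rows and columns of a Young diagram.  Only
    ['I_n] itself is 0-based, whence the successors below. *)

Definition one_line n (w : 'S_n) : seq nat := [seq (val (w x)).+1 | x <- enum 'I_n].

(** [letter w i] is w_i for 1 <= i <= n; other values of [i] are never used. *)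
Definition letter n (w : 'S_n) (i : nat) : nat := nth 0 (one_line w) i.-1.

Definition is_descent n (w : 'S_n) (d : nat) : bool :=
  [&& 1 <= d, d < n & letter w d.+1 < letter w d].

Definition grassmannian n (k : nat) (w : 'S_n) : Prop :=
  forall d, is_descent w d <-> d = k.

(** lambda_w = (w_k - k, ..., w_1 - 1), trailing zeros included.  The truncated
    subtraction is exact when w is k-Grassmannian, since then w_1 < ... < w_k. *)
Definition grass_shape n (k : nat) (w : 'S_n) : seq nat :=
  [seq letter w i - i | i <- rev (iota 1 k)].

Definition box (n : nat) := {b : 'I_n * 'I_n | b.1 < b.2}.
Definition row n (b : box n) : nat := (val b).1.+1.
Definition col n (b : box n) : nat := (val b).2.+1.

Definition Inv n (w : 'S_n) : {set box n} :=
  [set b | letter w (col b) < letter w (row b)].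

Definition filling (n : nat) := {ffun box n -> nat}.

Definition hook n (b : box n) : {set box n} :=
  [set c | [|| c == b,
               (col c == col b) && (row b < row c < col b)
             | (row c == row b) && (row b < col c < col b)]].

(** Used only on sequences of odd size (hooks have odd cardinality). *)
Definition median (s : seq nat) : nat := nth 0 (sort leq s) (size s)./2.

Record inversions_tableau n (w : 'S_n) (T : filling n) : Prop := {
  it_shaded : forall b, b \in Inv w -> 1 <= T b <= n;
  it_unshaded : forall b, b \notin Inv w -> T b = 0;
  it_median : forall b, T b = median [seq T c | c <- enum (hook b)];
  it_column : forall b c, b \in Inv w -> c \in Inv w ->
    col b = col c -> T b = T c -> b = c;
  it_flag : forall b, col b = (row b).+1 -> T b <= row b
}.

Definition in_diagram (lam : seq nat) (r c : nat) : bool :=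
  (1 <= r <= size lam) && (1 <= c <= nth 0 lam r.-1).

Record reverse_ssyt (lam : seq nat) (S : nat -> nat -> nat) : Prop := {
  rssyt_partition : sorted geq lam;
  rssyt_rows : forall r c, in_diagram lam r c -> in_diagram lam r c.+1 ->
    S r c.+1 <= S r c;
  rssyt_columns : forall r c, in_diagram lam r c -> in_diagram lam r.+1 c ->
    S r.+1 c < S r c
}.

(** The entry in row i and column j, or 0 if (i, j) is not a staircase box. *)
Definition entry n (T : filling n) (i j : nat) : nat :=
  if [pick b : box n | (row b == i) && (col b == j)] is Some b then T b else 0.

(** The boxes in [D] form a reverse semistandard tableau of shape [lam] with top
    left corner in position (k, k+1): cell (r, c) of the diagram sits in the box
    (k+1-r, k+c), as staircase rows are drawn with index increasing upwards.
    The conditions [row b + r = k.+1] avoid truncated subtraction. *)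
Record forms_reverse_ssyt n (k : nat) (lam : seq nat) (D : {set box n})
    (T : filling n) : Prop := {
  frs_cell_box : forall r c, in_diagram lam r c ->
    exists2 b, b \in D & row b + r = k.+1 /\ col b = k + c;
  frs_box_cell : forall b, b \in D ->
    exists r c, [/\ in_diagram lam r c, row b + r = k.+1 & col b = k + c];
  frs_tableau : reverse_ssyt lam (fun r c => entry T (k.+1 - r) (k + c))
}.

(* Main.v *)
Require Import Defs.
From mathcomp Require Import all_boot all_fingroup.
From mathcomp Require Import zify.

(** Write T(i, j) for the entries of the filling, with 0 in unshaded boxes.
    Besides (i, j), the hook of (i, j) consists of the pairs of boxes (i, m),
    (m, j) with i < m < j.  Both boxes of a pair are inversions only if
    w_i > w_m > w_j; a permutation with a single descent has no such pattern, so
    every pair contributes a zero.  If the hook has 2N + 1 boxes, these N zeros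
    are the N smallest entries, and the median is the least of the N + 1 others.
    Hence the median condition says exactly that
      T(i, j) <= T(i, m) + T(m, j)  whenever i < m < j,
    a sum with at most one nonzero term ([median_conditionE]).

    Inversions (i, j) of a k-Grassmannian permutation satisfy i <= k < j, so for
    m > k the inequality compares two entries of row i, and for m <= k two
    entries of column j: entries weakly decrease to the right along rows and
    weakly decrease away from row k along columns.  Distinctness in columns makes
    the latter strict.  The largest entry is thus the one in the corner
    (k, k+1), the only shaded box on the diagonal (i, i+1), and the flag
    condition there bounds all entries by k.

    It remains to see that the shaded region is the diagram of lambda_w
    ([inverted_length]).  The letters smaller than w_i, for i <= k, occur at the
    i - 1 positions before i and at the positions k+1, ..., k+l, where l is the
    number of shaded boxes in row i; so w_i - 1 = (i - 1) + l. *)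

(** * Medians of sequences with many zeros *)

Lemma sort_zeros N (u : seq nat) :
  sort leq (nseq N 0 ++ u) = nseq N 0 ++ sort leq u.
Proof.
apply: (sorted_eq leq_trans anti_leq); first exact: (sort_sorted leq_total).
  elim: N => [|N IH] /=; first exact: (sort_sorted leq_total).
  by rewrite path_min_sorted //; apply/allP.
by rewrite perm_sort perm_cat2l perm_sym perm_sort.
Qed.

(** Among 2N + 1 numbers, N zeros fill the places below the middle one. *)
Lemma median_zeros {s u : seq nat} {N} :
    perm_eq s (nseq N 0 ++ u) -> size u = N.+1 ->
  median s = head 0 (sort leq u).
Proof.
move=> s_perm u_size; rewrite /median -nth0.
have -> : sort leq s = nseq N 0 ++ sort leq u.
  by rewrite -sort_zeros; apply/perm_sortP => //;
    [exact: leq_total | exact: leq_trans | exact: anti_leq].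
have -> : (size s)./2 = N.
  by rewrite (perm_size s_perm) size_cat size_nseq u_size; lia.
by rewrite nth_cat size_nseq ltnn subnn.
Qed.

Lemma head_sort_eq (u : seq nat) x : x \in u ->
  x = head 0 (sort leq u) <-> {in u, forall y, x <= y}.
Proof.
move=> xu; have := sort_sorted leq_total u.
have memE := mem_sort leq u.
case: (sort leq u) memE => [|h v] memE /=; first by rewrite -memE in xu.
rewrite (path_sortedE leq_trans) => /andP[/allP h_min _].
have h_le y : y \in u -> h <= y.
  by rewrite -memE inE => /orP[/eqP-> //|/h_min].
split=> [-> // | x_le]; apply/eqP; rewrite eqn_leq h_le // andbT.
by apply: x_le; rewrite -memE mem_head.
Qed.

(** The shape in which hooks meet the median: [x] is the entry at the corner of
    the hook, [f m] and [g m] are the two entries indexed by [m] in its arms.  As one of them is 0, the other one is [f m + g m], and the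
    zeros can be split off without saying which side they lie on. *)
Lemma median_paired (s M : seq nat) (f g : nat -> nat) x :
    perm_eq s (x :: map f M ++ map g M) ->
    {in M, forall m, f m = 0 \/ g m = 0} ->
  x = median s <-> {in M, forall m, x <= f m + g m}.
Proof.
move=> s_perm fg0.
have perm_fg : perm_eq (map f M ++ map g M)
    (nseq (size M) 0 ++ [seq f m + g m | m <- M]).
  elim: M fg0 {s_perm} => //= m M IH fg0.
  have IH' : perm_eq (map f M ++ map g M)
    (nseq (size M) 0 ++ [seq f m + g m | m <- M]).
    by apply: IH => y yM; apply: fg0; rewrite inE yM orbT.
  apply/seq.permP => a; move/seq.permP/(_ a): IH'; rewrite /= !count_cat /=.
  have [->|->] := fg0 m (mem_head _ _); rewrite ?addn0 ?add0n; lia.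
have s_perm' : perm_eq s
    (nseq (size M) 0 ++ x :: [seq f m + g m | m <- M]).
  rewrite (perm_trans s_perm) // -(cat1s x) -(cat1s x [seq _ | _ <- _]).
  by rewrite perm_sym perm_catCA perm_cat2l perm_sym.
rewrite (median_zeros s_perm') /= ?size_map // head_sort_eq ?mem_head //.
split=> [x_le m mM | x_le y].
  by apply: x_le; rewrite inE (map_f (fun m => f m + g m)) ?orbT.
by rewrite inE => /orP[/eqP-> //|/mapP[m mM ->]]; apply: x_le.
Qed.

(** * Boxes of the staircase and their hooks *)

Section Boxes.

Context {n : nat}.

Lemma box_bounds (b : box n) : [&& 1 <= row b, row b < col b & col b <= n].
Proof. by case: b => [[i j] /= ij]; rewrite /row /col /= ltnS ij ltn_ord. Qed.

Lemma box_eq (b c : box n) : row b = row c -> col b = col c -> b = c.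
Proof.
case: b c => [[i j] ij] [[i' j'] ij'] /= [ii] [jj].
by apply/val_inj; congr pair; apply/val_inj.
Qed.

Lemma box_exists i j : 1 <= i -> i < j -> j <= n ->
  exists b : box n, row b = i /\ col b = j.
Proof.
move=> i1 ij jn.
have in_ : i.-1 < n by lia.
have jn_ : j.-1 < n by lia.
have ij_ : Ordinal in_ < Ordinal jn_ by rewrite /=; lia.
by exists (exist _ (Ordinal in_, Ordinal jn_) ij_); rewrite /row /col /=; lia.
Qed.

Lemma entryE (T : filling n) b : entry T (row b) (col b) = T b.
Proof.
rewrite /entry; case: pickP => [c /andP[/eqP rc /eqP cc] | /(_ b)].
  by rewrite (box_eq _ _ rc cc).
by rewrite !eqxx.
Qed.

(** Passing from boxes to pairs of indices lets the two arms of the hook be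
    indexed by the same interval, as [median_paired] requires. *)
Lemma hook_perm (T : filling n) b (i := row b) (j := col b)
    (M := iota i.+1 (j - i.+1)) :
  perm_eq [seq T c | c <- enum (hook b)]
    (entry T i j :: [seq entry T i m | m <- M] ++ [seq entry T m j | m <- M]).
Proof.
pose rc (c : box n) := (row c, col c).
have -> : [seq T c | c <- enum (hook b)] =
    [seq entry T p.1 p.2 | p <- [seq rc c | c <- enum (hook b)]].
  by rewrite -map_comp; apply: eq_map => c /=; rewrite entryE.
have -> : entry T i j :: [seq entry T i m | m <- M] ++ [seq entry T m j | m <- M]
    = [seq entry T p.1 p.2 | p <- (i, j) :: [seq (i, m) | m <- M] ++
        [seq (m, j) | m <- M]].
  by rewrite /= map_cat -!map_comp.
have ij := box_bounds b; rewrite -/i -/j in ij.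
apply: perm_map; apply: uniq_perm.
- rewrite map_inj_uniq ?enum_uniq // => c d rcE; apply: box_eq.
    exact: (congr1 fst rcE).
  exact: (congr1 snd rcE).
- rewrite /= cat_uniq !map_inj_uniq ?iota_uniq //; try by move=> x y [].
  rewrite mem_cat negb_or andbT /=.
  rewrite -andbA; apply/and3P; split.
  + by apply/mapP => -[m]; rewrite mem_iota => mM []; lia.
  + by apply/mapP => -[m]; rewrite mem_iota => mM []; lia.
  + apply/hasPn => p /mapP[m mM ->]; apply/mapP => -[m' m'M] [].
    by move: mM m'M; rewrite !mem_iota; lia.
move=> [p q]; rewrite inE mem_cat; apply/mapP/idP => [[c] | ].
  rewrite mem_enum inE => hc [-> ->]; case/or3P: hc => [/eqP->|/andP[]|/andP[]].
  - by rewrite eqxx.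
  - move=> /eqP cj ci; apply/orP; right; apply/orP; right; apply/mapP.
    by exists (row c); rewrite ?cj // mem_iota /i /j; lia.
  - move=> /eqP ci cj; apply/orP; right; apply/orP; left; apply/mapP.
    by exists (col c); rewrite ?ci // mem_iota /i /j; lia.
case/or3P => [/eqP[-> ->] | /mapP[m] | /mapP[m]].
- by exists b; rewrite // mem_enum inE eqxx.
- rewrite mem_iota => mM [-> ->].
  have [c [ri cm]] : exists c : box n, row c = i /\ col c = m.
    by apply: box_exists; lia.
  exists c; last by rewrite /rc ri cm.
  by rewrite mem_enum inE ri cm eqxx; apply/or3P/Or33; lia.
- rewrite mem_iota => mM [-> ->].
  have [c [ri cm]] : exists c : box n, row c = m /\ col c = j.
    by apply: box_exists; lia.
  exists c; last by rewrite /rc ri cm.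
  by rewrite mem_enum inE ri cm eqxx; apply/or3P/Or32; lia.
Qed.

End Boxes.

(** * Letters and inversions *)

Section Letters.

Context {n : nat} (w : 'S_n).

Lemma letterE (x : 'I_n) : letter w x.+1 = (w x).+1.
Proof.
rewrite /letter /one_line /= (nth_map x) ?size_enum_ord //.
by rewrite nth_ord_enum.
Qed.

Lemma letter_bounds i : 1 <= i <= n -> 1 <= letter w i <= n.
Proof.
case: i => // i /= i_n; have := letterE (Ordinal i_n) => /= ->.
by rewrite ltn_ord.
Qed.

Lemma letter_inj i j : 1 <= i <= n -> 1 <= j <= n ->
  letter w i = letter w j -> i = j.
Proof.
case: i j => // i [] // j /= i_n j_n.
have := letterE (Ordinal i_n); have := letterE (Ordinal j_n) => /= -> ->.
by case=> /val_inj/perm_inj[->].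
Qed.

Lemma letter_surj v : 1 <= v <= n -> exists2 i, 1 <= i <= n & letter w i = v.
Proof.
case: v => // v /= v_n; exists (w^-1%g (Ordinal v_n)).+1; first by rewrite /= ltn_ord.
by rewrite letterE permKV.
Qed.

(** Membership in [Inv w] for a pair of indices, with the bounds that make the
    pair a box, so that shadedness can be discussed without building boxes. *)
Definition inverted i j := [&& 1 <= i, i < j, j <= n & letter w j < letter w i].

Lemma in_InvE b : (b \in Inv w) = inverted (row b) (col b).
Proof. by rewrite inE /inverted; case/and3P: (box_bounds b) => -> -> ->. Qed.

Lemma inverted_box i j : inverted i j ->
  exists2 b, b \in Inv w & row b = i /\ col b = j.
Proof.
move=> inv_ij; case/and4P: (inv_ij) => i1 ij jn _.
have [b [ri cj]] := box_exists i j i1 ij jn.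
by exists b; rewrite // in_InvE ri cj.
Qed.

Lemma entry_uninverted (T : filling n) i j :
    (forall b, b \notin Inv w -> T b = 0) ->
  ~~ inverted i j -> entry T i j = 0.
Proof.
move=> T0; rewrite /entry; case: pickP => // b /andP[/eqP<- /eqP<-].
by rewrite -in_InvE => /T0.
Qed.

End Letters.

(** * Inversions of a Grassmannian permutation *)

Section Grassmannian.

Context {n k : nat} {w : 'S_n} (hw : grassmannian k w).

Lemma descent_bounds : 1 <= k < n.
Proof. by have [_ /(_ erefl)/and3P[-> ->]] := hw k. Qed.

Lemma letter_step d : 1 <= d -> d < n -> d != k -> letter w d < letter w d.+1.
Proof.
move=> d1 dn dk.
have not_desc : ~~ is_descent w d by apply/negP => /hw/eqP; apply/negP.
rewrite ltn_neqAle; apply/andP; split.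
  by apply/eqP => /letter_inj; lia.
by move: not_desc; rewrite /is_descent d1 dn /= -leqNgt.
Qed.

Lemma letter_mono i j : 1 <= i -> i < j -> j <= n -> (j <= k) || (k < i) ->
  letter w i < letter w j.
Proof.
move=> i1; elim: j => // j IH ij jn side.
have step : letter w j < letter w j.+1 by apply: letter_step; lia.
have [i_j|j_i] := ltnP i j; first by apply: ltn_trans step; apply: IH; lia.
by have -> : i = j by lia.
Qed.

Lemma inverted_straddle {i j} : inverted w i j -> i <= k < j.
Proof.
case/and4P => i1 ij jn wij.
by have := letter_mono i j i1 ij jn; lia.
Qed.

Lemma entry_not_straddling {T : filling n} :
    (forall b, b \notin Inv w -> T b = 0) ->
  forall i j, ~~ (i <= k < j) -> entry T i j = 0.
Proof.
move=> T0 i j; move/(contra inverted_straddle).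
exact: entry_uninverted T0.
Qed.

Lemma inverted_left i j m : inverted w i j -> k < m -> m <= j -> inverted w i m.
Proof.
move=> inv_ij km mj; have := inverted_straddle inv_ij.
case/and4P: inv_ij => i1 ij jn wij ik; apply/and4P; split; try lia.
have [->//|m_j] := eqVneq m j.
by apply: ltn_trans wij; apply: letter_mono; lia.
Qed.

Lemma inverted_up i j m : inverted w i j -> i <= m -> m <= k -> inverted w m j.
Proof.
move=> inv_ij im mk; have := inverted_straddle inv_ij.
case/and4P: inv_ij => i1 ij jn wij ik; apply/and4P; split; try lia.
have [<-//|i_m] := eqVneq i m.
by apply: (ltn_trans wij); apply: letter_mono; lia.
Qed.

(** Letters smaller than w_i are counted in two ways.  If (i, j) is an inversion,
    the letters at positions 1, ..., i-1 and k+1, ..., j are all smaller than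
    w_i; if it is not, all smaller letters occur at positions 1, ..., i-1 and
    k+1, ..., j-1.  The second count also holds for j > n, which is why the
    equivalence holds beyond the staircase and confines the diagram to it. *)
Lemma inverted_length i j : 1 <= i <= k -> k < j ->
  inverted w i j = (j - k <= letter w i - i).
Proof.
move=> /andP[i1 ik] kj; have /andP[k1 kn] := descent_bounds.
have wi_bounds : 1 <= letter w i <= n by apply: letter_bounds; lia.
apply/idP/idP => [inv_ij | ].
  case/and4P: (inv_ij) => _ ij jn wij.
  pose P := iota 1 i.-1 ++ iota k.+1 (j - k).
  have memP x : (x \in P) = (1 <= x < i) || (k < x <= j).
    by rewrite mem_cat !mem_iota; lia.
  have : size (map (letter w) P) <= size (iota 1 (letter w i).-1).
    apply: uniq_leq_size.
      rewrite map_inj_in_uniq => [|x y].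
        rewrite cat_uniq !iota_uniq andbT /=.
        by apply/hasPn => x; rewrite !mem_iota; lia.
      by rewrite !memP => xP yP; apply: letter_inj; lia.
    move=> v /mapP[x]; rewrite memP => xP ->; rewrite mem_iota.
    have x_bounds : 1 <= letter w x <= n by apply: letter_bounds; lia.
    suff : letter w x < letter w i by lia.
    case/orP: xP => xP; first by apply: letter_mono; lia.
    have : inverted w i x by apply: (inverted_left i j x); lia.
    by case/and4P.
  by rewrite size_map size_cat !size_iota; lia.
apply: contraTT => ninv; rewrite -ltnNge.
pose P := iota 1 i.-1 ++ iota k.+1 (j - k.+1).
have : size (iota 1 (letter w i).-1) <= size (map (letter w) P).
  apply: uniq_leq_size; first exact: iota_uniq.
  move=> v; rewrite mem_iota => vP.
  have v_n : 1 <= v <= n by lia.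
  have [x x_n wx] := letter_surj w v v_n.
  rewrite -wx; apply: map_f; rewrite mem_cat !mem_iota.
  have x_i : x < i \/ k < x.
    have [?|ix] := ltnP x i; first by left.
    have [?|xk] := ltnP k x; first by right.
    have [xi|xi] := eqVneq i x; first by subst x; lia.
    by have := letter_mono i x; lia.
  case: x_i => [|kx]; first by lia.
  have inv_ix : inverted w i x by apply/and4P; split; lia.
  suff : x < j by lia.
  rewrite ltnNge; apply/negP => jx; case/negP: ninv.
  exact: (inverted_left i x j).
by rewrite size_map size_cat !size_iota; lia.
Qed.

Lemma in_diagramE r c :
  in_diagram (grass_shape k w) r c =
    [&& 1 <= r <= k, 1 <= c & inverted w (k.+1 - r) (k + c)].
Proof.
rewrite /in_diagram /grass_shape size_map size_rev size_iota.
have [r_k|//] := boolP (1 <= r <= k).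
rewrite (nth_map 0) ?size_rev ?size_iota; last by lia.
rewrite nth_rev ?size_iota; last by lia.
rewrite nth_iota; last by lia.
have -> : 1 + (k - r.-1.+1) = k.+1 - r by lia.
case: c => // c; rewrite inverted_length; [|lia|lia].
by rewrite addKn.
Qed.

Lemma grass_shape_partition : sorted geq (grass_shape k w).
Proof.
have /andP[k1 kn] := descent_bounds.
apply/(sortedP 0) => r; rewrite /grass_shape size_map size_rev size_iota => rk.
rewrite !(nth_map 0) ?size_rev ?size_iota; try lia.
rewrite !nth_rev ?size_iota; try lia.
rewrite !nth_iota; try lia.
have -> : 1 + (k - r.+1) = (1 + (k - r.+2)).+1 by lia.
have : letter w (1 + (k - r.+2)) < letter w (1 + (k - r.+2)).+1.
  by apply: letter_step; lia.
rewrite /=; lia.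
Qed.

(** * The median condition *)

(** One of T(i, m), T(m, j) vanishes: the first if m <= k, the second if m > k. *)
Lemma median_conditionE (T : filling n) :
    (forall b, b \notin Inv w -> T b = 0) ->
  (forall b, T b = median [seq T c | c <- enum (hook b)]) <->
  (forall i m j, 1 <= i -> i < m -> m < j -> j <= n ->
    entry T i j <= entry T i m + entry T m j).
Proof.
move=> T0.
have hookE b := median_paired _ _ _ _ _ (hook_perm T b).
have vanish := entry_not_straddling T0.
have one_zero i j : {in iota i.+1 (j - i.+1), forall m,
    entry T i m = 0 \/ entry T m j = 0}.
  move=> m _; have [km|mk] := ltnP k m; [right|left]; apply: vanish; lia.
split=> [med i m j i1 im mj jn | tri b].
  have [b [ri cj]] : exists b : box n, row b = i /\ col b = j.
    by apply: box_exists; lia.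
  have /hookE H := one_zero (row b) (col b).
  have := med b; rewrite -{1}(entryE T b) => /H.
  by rewrite ri cj => /(_ m); apply; rewrite mem_iota; lia.
have /hookE H := one_zero (row b) (col b).
rewrite -{1}(entryE T b); apply/H => m; rewrite mem_iota => mM.
by have := box_bounds b; move=> bb; apply: tri; lia.
Qed.

(** * The two inclusions *)

(** The local inequality of [median_conditionE] already compares any two boxes of
    a row or column, so adjacency in the diagram is a special case. *)
Lemma inversions_tableau_rssyt (T : filling n) : inversions_tableau w T ->
  [/\ forall b, b \notin Inv w -> T b = 0,
      forms_reverse_ssyt k (grass_shape k w) (Inv w) T
    & forall b, b \in Inv w -> 1 <= T b <= k].
Proof.
case=> shaded T0 /(median_conditionE T T0) tri inj flag.
have /andP[k1 kn] := descent_bounds.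
have vanish := entry_not_straddling T0.
have row_le i m j : 1 <= i <= k -> k < m -> m <= j <= n ->
    entry T i j <= entry T i m.
  move=> ik km /andP[mj jn]; have [->//|m_j] := eqVneq m j.
  by have := tri i m j; rewrite (vanish m j); lia.
have col_le i m j : 1 <= i -> i <= m <= k -> k < j <= n ->
    entry T i j <= entry T m j.
  move=> i1 /andP[im mk] kj; have [->//|i_m] := eqVneq i m.
  by have := tri i m j; rewrite (vanish i m); lia.
split=> // [|b b_inv].
  split=> [r c|b|].
  - by rewrite in_diagramE => /and3P[r_k c1 /inverted_box[b b_inv [ri cj]]];
      exists b; rewrite // ri cj; lia.
  - rewrite in_InvE => b_inv; have kb := inverted_straddle b_inv.
    have bb := box_bounds b.
    exists (k.+1 - row b), (col b - k); rewrite in_diagramE.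
    have -> : k.+1 - (k.+1 - row b) = row b by lia.
    have -> : k + (col b - k) = col b by lia.
    by split; [apply/and3P; split=> //; lia | lia | ].
  split=> [|r c|r c]; first exact: grass_shape_partition.
    rewrite !in_diagramE => /and3P[_ c1 _] /and3P[r_k _ /and4P[_ _ jn _]].
    by apply: row_le; lia.
  rewrite !in_diagramE => /and3P[r_pos c1 inv1] /and3P[r_k _ inv2].
  have [b1 b1_inv [r1 c1']] := inverted_box _ _ _ inv1.
  have [b2 b2_inv [r2 c2']] := inverted_box _ _ _ inv2.
  rewrite ltn_neqAle; apply/andP; split.
    apply/eqP; rewrite -r1 -r2 -{1}c2' -c1' !entryE => T21.
    have b21 : b2 = b1 by apply: inj => //; rewrite c1' c2'.
    by move: r1 r2; rewrite b21; lia.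
  by case/and4P: inv1 => _ _ jn _; apply: col_le; lia.
have /andP[-> _] := shaded b b_inv; rewrite /=.
rewrite in_InvE in b_inv; have kb := inverted_straddle b_inv.
have bb := box_bounds b.
(* The corner (k, k+1) dominates every entry and carries the flag condition. *)
have [b0 [r0 c0]] : exists b0 : box n, row b0 = k /\ col b0 = k.+1.
  by apply: box_exists; lia.
have := flag b0; rewrite -!entryE r0 c0 => /(_ erefl); apply: leq_trans.
apply: (@leq_trans (entry T k (col b))); first by apply: col_le; lia.
by apply: row_le; lia.
Qed.

(** Here the adjacent comparisons have to be chained; the boxes passed on the way
    are shaded because the shaded region is closed under moving left and up
    towards the corner ([inverted_left], [inverted_up]). *)
Lemma rssyt_inversions_tableau (T : filling n) :
    (forall b, b \notin Inv w -> T b = 0) ->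
    forms_reverse_ssyt k (grass_shape k w) (Inv w) T ->
    (forall b, b \in Inv w -> 1 <= T b <= k) ->
  inversions_tableau w T.
Proof.
move=> T0 [_ _ [_ rows cols]] T_k.
have /andP[k1 kn] := descent_bounds.
have row_le i j m : inverted w i j -> k < m -> m <= j ->
    entry T i j <= entry T i m.
  elim: j => [/and4P[]|j IH inv_ij km mj]; first by [].
  have [->//|m_j] := eqVneq m j.+1.
  have inv_ij' : inverted w i j by apply: (inverted_left i j.+1) => //; lia.
  apply: leq_trans (IH _ _ _) => //; last by lia.
  have := rows (k.+1 - i) (j - k); rewrite !in_diagramE.
  have ik := inverted_straddle inv_ij'; have /and3P[i1 _ _] := inv_ij.
  have -> : k.+1 - (k.+1 - i) = i by lia.
  have -> : k + (j - k).+1 = j.+1 by lia.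
  have -> : k + (j - k) = j by lia.
  by rewrite inv_ij inv_ij'; apply; lia.
have col_lt i j m : inverted w i j -> i < m -> m <= k ->
    entry T i j < entry T m j.
  move=> inv_ij; elim: m => // m IH im mk.
  have inv_m : inverted w m j by apply: (inverted_up i) => //; lia.
  have inv_m1 : inverted w m.+1 j by apply: (inverted_up i) => //; lia.
  have step : entry T m j < entry T m.+1 j.
    have := cols (k - m) (j - k); rewrite !in_diagramE.
    have ik := inverted_straddle inv_ij; have /and3P[i1 _ _] := inv_ij.
    have -> : k.+1 - (k - m) = m.+1 by lia.
    have -> : k.+1 - (k - m).+1 = m by lia.
    have -> : k + (j - k) = j by lia.
    by rewrite inv_m inv_m1; apply; lia.
  have [i_m|m_i] := ltnP i m; first by apply: ltn_trans step; apply: IH; lia.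
  by have -> : i = m by lia.
split=> // [b /T_k | | b c | b b_diag].
- by lia.
- apply/(median_conditionE T T0) => i m j i1 im mj jn.
  have [inv_ij|ninv] := boolP (inverted w i j); last first.
    by rewrite (entry_uninverted w _ _ _ T0 ninv).
  (* The box compared with (i, j) lies in its row if m > k, else in its column. *)
  have [km|mk] := ltnP k m.
    by apply: leq_trans (leq_addr _ _); apply: row_le => //; exact: ltnW.
  by apply: leq_trans (leq_addl _ _); apply: ltnW; apply: col_lt.
- rewrite !in_InvE => b_inv c_inv bc; rewrite -!entryE -bc => Tbc.
  have kb := inverted_straddle b_inv; have kc := inverted_straddle c_inv.
  apply: box_eq => //; case: (ltngtP (row b) (row c)) => // rr.
    by have := col_lt _ _ (row c) b_inv; lia.
  by rewrite -bc in c_inv; have := col_lt _ _ (row b) c_inv; lia.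
- have [b_inv|/T0-> //] := boolP (b \in Inv w).
  have := T_k b b_inv; move: b_inv; rewrite in_InvE b_diag => /inverted_straddle.
  by lia.
Qed.

End Grassmannian.

Theorem proposition5p2 (n k : nat) (w : 'S_n) (hw : grassmannian k w)
    (T : filling n) :
  inversions_tableau w T <->
  [/\ forall b : box n, b \notin Inv w -> T b = 0,
      forms_reverse_ssyt k (grass_shape k w) (Inv w) T
    & forall b : box n, b \in Inv w -> 1 <= T b <= k].
Proof.
split; first exact: inversions_tableau_rssyt.
by case; exact: rssyt_inversions_tableau.
Qed.
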